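(* Assume Conditions (i), (ii), (iii). Then for almost every $\omega$, $X^\omega$ is a union of finitely many Lipschitz periodic curves: there exist $r^\omega\in\mathbb N$ and Lipschitz continuous functions $\varphi_1^\omega,\dots,\varphi_{r^\omega}^\omega:\mathbb R\to\mathbb R^d$, with $\varphi_i^\omega$ periodic of period $\tau_i^\omega\in\mathbb N$, such that $$X^\omega=\bigcup_{i=1}^{r^\omega}L_i^\omega,\qquad L_i^\omega=\{(s\bmod 1,\varphi_i^\omega(s)):s\in[0,\tau_i^\omega)\},$$ the curves $L_i^\omega$ being pairwise distinct.
   Context: Setting. $(\Omega,\mathcal F,P,(\theta_t)_{t\in\mathbb R})$ is a metric dynamical system: each $\theta_t:\Omega\to\Omega$ is measurable and $P$-preserving, $\theta_0=\mathrm{id}$, $\theta_{t+u}=\theta_t\circ\theta_u$. $S^1=\mathbb R/\mathbb Z$; distances $|s-s'|$ and intervals $[s-\delta,s+\delta]$ on $S^1$ are taken in the lifted real coordinate. A $C^1$ perfect cocycle is a measurable map $\gamma:\mathbb R\times\Omega\times(S^1\times\mathbb R^d)\to S^1\times\mathbb R^d$, $(t,\omega,z)\mapsto \gamma^\omega_z(t)=\gamma^\omega(t)z$, such that for every $\omega$: $\gamma^\omega(0)=\mathrm{id}$; $\gamma^\omega_z(t_1+t_2)=\gamma^{\theta_{t_1}\omega}_{\gamma^\omega_z(t_1)}(t_2)$ for all $z$, $t_1,t_2$; $(t,z)\mapsto\gamma^\omega_z(t)$ is continuous; each $\gamma^\omega(t)$ is a $C^1$ diffeomorphism. Throughout, $\gamma$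 is a $C^1$ perfect cocycle. Condition (i): there are a random compact set $\omega\mapsto Y^\omega\subset\mathbb R^d$ and $t_1>0$ such that for all $s\in S^1$, $y\in Y^\omega$, writing $\gamma^\omega_{(s,y)}(t_1)=(s',y')$, the continuous lift of the $S^1$-coordinate along $t\mapsto\gamma^\omega_{(s,y)}(t)$, $t\in[0,t_1]$, increases by exactly $1$ (i.e. $s'=s+1$ in the lift), and $y'\in Y^{\theta_{t_1}\omega}$; moreover there is a random compact set $X^\omega\subset S^1\times Y^\omega$ with $\gamma^\omega(t)X^\omega=X^{\theta_t\omega}$ for all $t\in\mathbb R$, whose projection onto $S^1$ is all of $S^1$, and whose diameter in the $y$-direction is less than a constant $b^*>0$. Notation. $\hat\theta=\theta_{t_1}$ and $\hat\theta^k$ is its $k$-fold iterate ($k\in\mathbb Z$). $H^\omega(s,y):=\gamma^\omega_{(s,y)}(t_1)=(h(s)\bmod 1,g^\omega(s,y))$ with $h(s)=s+1$; $H^{(n),\omega}:=H^{\hat\theta^{n-1}\omega}\circ\dots\circ H^\omega=(h^{(n)}(s)\bmod1,g^{(n),\omega}(s,y))$. Condition (ii): there are $\delta_1>0$, $L_1>0$ such that for every $(s,y)\in X^\omega$ there is a Lipschitz function $f:S^1\to\mathbb R^d$ with constant $L_1$, $f(s)=y$, and $(s^\#,f(s^\#))\in X^\omega$ for all $s^\#\in[s-\delta_1,s+\delta_1]$. For $\varepsilon>0$, $B(X^\omega,\varepsilon):=\{(s,y'):\exists (s,y)\in X^\omega,\ \|y'-y\|\le\varepsilon\}$. Condition (iii):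 there are $\lambda<1$, $\varepsilon_1>0$, $n_0\in\mathbb N$ such that for a.e. $\omega$, $\|D_yg^{(n_0),\omega}(s,y)\|\le\lambda$ for all $(s,y)\in B(X^\omega,\varepsilon_1)$, and $c:=\operatorname{ess\,sup}_\omega\sup_{(s,y)\in B(X^\omega,\varepsilon_1)}\|\partial_s g^{(n_0),\omega}(s,y)\|<\infty$. *)

(* Defs.v *)
From HB Require Import structures.
From mathcomp Require Import all_boot all_order all_algebra.
From mathcomp Require Import all_classical all_reals all_analysis.

Set Implicit Arguments.
Unset Strict Implicit.
Unset Printing Implicit Defensive.

Import Order.TTheory GRing.Theory Num.Theory.
Import numFieldNormedType.Exports.
Local Open Scope classical_set_scope.
Local Open Scope ring_scope.

(* Conventions:
   - R^d is the row-vector space 'rV[R]_d, normed by the Euclidean norm [eucl].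
   - S^1 x R^d is encoded through its universal cover R x R^d: a subset of
     S^1 x R^d is encoded by its (1-periodic in the first coordinate) preimage,
     and the cocycle gamma is given by its continuous lift (the one with
     gamma(0) = id), which commutes with the deck translation (s,y)|->(s+1,y). *)

Section Defs.
Variable R : realType.

Definition eucl (d : nat) (v : 'rV[R]_d) : R :=
  Num.sqrt (\sum_(i < d) (v ord0 i) ^+ 2).

Definition mod1_eq (s s' : R) : Prop := exists k : int, s' = s + k%:~R.

(* lifted maps of S^1 x R^d (degree one in the circle variable) *)
Definition deck_equivariant (d : nat) (F : R * 'rV[R]_d -> R * 'rV[R]_d) :=
  forall s y, F (s + 1, y) = ((F (s, y)).1 + 1, (F (s, y)).2).

Definition periodic_set (d : nat) (A : set (R * 'rV[R]_d)) :=
  forall s y, A (s, y) <-> A (s + 1, y).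

Definition compact_circ (d : nat) (A : set (R * 'rV[R]_d)) :=
  periodic_set A /\ compact (A `&` [set z | 0 <= z.1 <= 1]).

(* C^1 maps between (finite-dimensional) normed spaces: differentiable
   everywhere with continuous differential (tested on every vector) *)
Definition C1 (V W : normedModType R) (F : V -> W) :=
  (forall x, differentiable F x) /\ (forall v, continuous (fun x => 'd F x v)).

Definition C1_diffeo (V : normedModType R) (F : V -> V) :=
  exists G : V -> V, [/\ cancel F G, cancel G F, C1 F & C1 G].

Definition dist_to (V : normedModType R) (x : V) (A : set V) : R :=
  inf [set `|x - z| | z in A].

Context {dO : measure_display} {Omega : measurableType dO}.

Definition metric_dynamical_system (P : probability Omega R)
    (theta : R -> Omega -> Omega) :=
  [/\ forall t, measurable_fun setT (theta t),
      forall t (A : set Omega), measurable A ->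
        P (theta t @^-1` A) = P A,
      theta 0 = id &
      forall t u, theta (t + u) = theta t \o theta u].

Definition random_compact (d : nat) (Y : Omega -> set 'rV[R]_d) :=
  (forall w, compact (Y w)) /\
  (forall y, measurable_fun setT (fun w => dist_to y (Y w))).

Definition random_compact_circ (d : nat) (X : Omega -> set (R * 'rV[R]_d)) :=
  (forall w, compact_circ (X w)) /\
  (forall z, measurable_fun setT (fun w => dist_to z (X w))).

Definition C1_perfect_cocycle (d : nat) (theta : R -> Omega -> Omega)
    (gamma : R -> Omega -> R * 'rV[R]_d -> R * 'rV[R]_d) :=
  (forall t z, measurable_fun setT (fun w => (gamma t w z).1) /\
     forall i, measurable_fun setT (fun w => (gamma t w z).2 ord0 i)) /\
  forall w,
  [/\ gamma 0 w = id,
      forall t1 t2 z, gamma (t1 + t2) w z = gamma t2 (theta t1 w) (gamma t1 w z),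
      continuous (fun p : R * (R * 'rV[R]_d) => gamma p.1 w p.2),
      forall t, deck_equivariant (gamma t w) &
      forall t, C1_diffeo (gamma t w)].

Fixpoint Hn (d : nat) (theta : R -> Omega -> Omega)
    (gamma : R -> Omega -> R * 'rV[R]_d -> R * 'rV[R]_d) (t1 : R)
    (n : nat) (w : Omega) : R * 'rV[R]_d -> R * 'rV[R]_d :=
  match n with
  | 0 => id
  | n'.+1 => gamma t1 (iter n' (theta t1) w) \o Hn theta gamma t1 n' w
  end.

Definition Bnbhd (d : nat) (A : set (R * 'rV[R]_d)) (eps : R) :=
  [set z | exists y, A (z.1, y) /\ eucl (z.2 - y) <= eps].

Definition condition_i (d : nat) (theta : R -> Omega -> Omega)
    (gamma : R -> Omega -> R * 'rV[R]_d -> R * 'rV[R]_d)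
    (Y : Omega -> set 'rV[R]_d) (X : Omega -> set (R * 'rV[R]_d)) (t1 : R) :=
  [/\ random_compact Y, 0 < t1,
      (forall w s y, Y w y ->
         (gamma t1 w (s, y)).1 = s + 1 /\ Y (theta t1 w) (gamma t1 w (s, y)).2),
      random_compact_circ X &
      [/\ forall w t, gamma t w @` X w = X (theta t w),
          forall w z, X w z -> Y w z.2,
          forall w s, exists y, X w (s, y) &
          exists bstar : R, 0 < bstar /\
            forall w s y y', X w (s, y) -> X w (s, y') -> eucl (y - y') < bstar]].

Definition condition_ii (d : nat) (X : Omega -> set (R * 'rV[R]_d)) :=
  exists delta1 L1 : R, [/\ 0 < delta1, 0 < L1 &
    forall w s y, X w (s, y) ->
      exists f : R -> 'rV[R]_d,
        [/\ forall u, f (u + 1) = f u,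
            forall u u', eucl (f u - f u') <= L1 * `|u - u'|,
            f s = y &
            forall u, s - delta1 <= u <= s + delta1 -> X w (u, f u)]].

Definition condition_iii (d : nat) (P : probability Omega R)
    (theta : R -> Omega -> Omega)
    (gamma : R -> Omega -> R * 'rV[R]_d -> R * 'rV[R]_d)
    (X : Omega -> set (R * 'rV[R]_d)) (t1 : R) :=
  exists (lambda eps1 : R) (n0 : nat), [/\ lambda < 1, 0 < eps1,
    {ae P, forall w, forall z, Bnbhd (X w) eps1 z -> forall v : 'rV[R]_d,
       eucl ('d (fun x => (Hn theta gamma t1 n0 w x).2) z (0, v))
         <= lambda * eucl v} &
    exists c : R,
    {ae P, forall w, forall z, Bnbhd (X w) eps1 z ->
       eucl ('d (fun x => (Hn theta gamma t1 n0 w x).2) z (1, 0)) <= c}].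

Definition curve (d : nat) (phi : R -> 'rV[R]_d) (tau : nat) :
  set (R * 'rV[R]_d) :=
  [set z | exists u, [/\ 0 <= u < tau%:R, mod1_eq u z.1 & z.2 = phi u]].

Definition lipschitz_fun (d : nat) (phi : R -> 'rV[R]_d) :=
  exists L : R, forall u u', eucl (phi u - phi u') <= L * `|u - u'|.

End Defs.

(* Main.v *)
(* For almost every w the contraction holds along the whole backward orbit of w.
   Two points of a fibre of X w that stay within eps1 of each other along the
   backward orbit must coincide, so any finite list of distinct points of a
   fibre becomes eps1-separated once pulled back far enough.  As fibres have
   bounded diameter, packing bounds their cardinality.  The Lipschitz branches
   through the pulled back, separated points stay disjoint on an interval of
   uniform length, and pushing them forward shows that all fibres of X w have
   the same finite cardinality.  Hence branches of X w cannot merge or split: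
   through each point passes exactly one global Lipschitz branch, and by the
   pigeonhole principle it is periodic with an integer period. *)
Require Import Defs.
From HB Require Import structures.
From mathcomp Require Import all_boot all_order all_algebra.
From mathcomp Require Import all_classical all_reals all_analysis.
From mathcomp Require Import ring lra.
Import Order.TTheory GRing.Theory Num.Theory.
Import numFieldNormedType.Exports.
Local Open Scope classical_set_scope.
Local Open Scope ring_scope.

Set Implicit Arguments.
Unset Strict Implicit.

(** * Euclidean norm on row vectors: Cauchy-Schwarz, separation and packing *)

Section EuclideanNorm.
Variables (R : realType) (d : nat).
Implicit Types u v w : 'rV[R]_d.

Definition dotr u v : R := \sum_(i < d) u ord0 i * v ord0 i.

Lemma eucl_ge0 v : 0 <= eucl v.
Proof. exact: sqrtr_ge0. Qed.

Lemma eucl_sqr v : eucl v ^+ 2 = dotr v v.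
Proof.
rewrite sqr_sqrtr; first by apply: eq_bigr => i _; rewrite expr2.
by apply: sumr_ge0 => i _; exact: sqr_ge0.
Qed.

(** Cauchy-Schwarz: with [A], [B] the squared norms of [u], [v] and [C] their inner product, the
    vector [B u - C v] has squared norm [B * (B * A - C ^+ 2)]. *)
Lemma dotr_le_eucl u v : dotr u v <= eucl u * eucl v.
Proof.
have [v0|v_neq0] := eqVneq (eucl v) 0.
  have vi0 i : v ord0 i = 0.
    have : dotr v v = 0 by rewrite -eucl_sqr v0 expr0n.
    move/eqP; rewrite psumr_eq0; last by move=> j _; rewrite -expr2 sqr_ge0.
    by move=> /allP/(_ i (mem_index_enum _)) /=; rewrite -expr2 sqrf_eq0 => /eqP.
  by rewrite v0 mulr0 /dotr big1 // => i _; rewrite vi0 mulr0.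
have v_gt0 : 0 < eucl v by rewrite lt_def v_neq0 eucl_ge0.
(* The negated claim makes the inner product nonnegative, which allows comparing squares at the
   end. *)
rewrite real_leNgt ?num_real //; apply/negP => lt_uv.
set A := dotr u u; set B := dotr v v; set C := dotr u v.
have : 0 <= \sum_(i < d) (B * u ord0 i - C * v ord0 i) ^+ 2.
  by apply: sumr_ge0 => i _; exact: sqr_ge0.
have -> : \sum_(i < d) (B * u ord0 i - C * v ord0 i) ^+ 2 = B * (B * A - C ^+ 2).
  transitivity (B ^+ 2 * A - 2 * B * C * C + C ^+ 2 * B); last by ring.
  suff E b c : \sum_(i < d) (b * u ord0 i - c * v ord0 i) ^+ 2 =
      b ^+ 2 * dotr u u - 2 * b * c * dotr u v + c ^+ 2 * dotr v v by exact: E.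
  rewrite /dotr !mulr_sumr -sumrB -big_split /=.
  by apply: eq_bigr => i _; ring.
have B_gt0 : 0 < B by rewrite /B -eucl_sqr exprn_gt0.
rewrite pmulr_rge0 // /A /B -!eucl_sqr subr_ge0 -exprMn mulrC.
rewrite ler_sqr ?nnegrE ?mulr_ge0 ?eucl_ge0 //; first by rewrite leNgt lt_uv.
by rewrite (le_trans _ (ltW lt_uv)) // mulr_ge0 ?eucl_ge0.
Qed.

Lemma eucl_coord_le v i : `|v ord0 i| <= eucl v.
Proof.
rewrite -sqrtr_sqr ler_sqrt ?sumr_ge0 // => [|j _]; last exact: sqr_ge0.
by rewrite (bigD1 i) //= lerDl sumr_ge0 // => j _; exact: sqr_ge0.
Qed.

Lemma eucl_le_sum v : eucl v <= \sum_(i < d) `|v ord0 i|.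
Proof.
have s_ge0 : 0 <= \sum_(i < d) `|v ord0 i| by exact: sumr_ge0.
rewrite -ler_sqr ?nnegrE ?eucl_ge0 // eucl_sqr expr2 mulr_suml ler_sum // => i _.
rewrite (le_trans (ler_norm _)) // normrM ler_wpM2l //.
by rewrite (bigD1 i) //= lerDl sumr_ge0.
Qed.

Lemma eucl_eq0 v : (eucl v == 0) = (v == 0).
Proof.
apply/eqP/eqP => [v0|->].
  apply/rowP => i; apply/eqP; rewrite mxE -normr_le0 -v0.
  exact: eucl_coord_le.
apply/eqP; rewrite eq_le eucl_ge0 andbT (le_trans (eucl_le_sum _)) //.
by rewrite big1 // => i _; rewrite mxE normr0.
Qed.

Lemma euclN v : eucl (- v) = eucl v.
Proof. by congr Num.sqrt; apply: eq_bigr => i _; rewrite mxE sqrrN. Qed.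

Lemma euclB u v : eucl (u - v) = eucl (v - u).
Proof. by rewrite -euclN opprB. Qed.

Lemma euclD u v : eucl (u + v) <= eucl u + eucl v.
Proof.
rewrite -ler_sqr ?nnegrE ?addr_ge0 ?eucl_ge0 // sqrrD !eucl_sqr.
have -> : dotr (u + v) (u + v) = dotr u u + dotr u v *+ 2 + dotr v v.
  rewrite /dotr -sumrMnl -!big_split /=; apply: eq_bigr => i _; rewrite mxE; ring.
by rewrite lerD2r lerD2l ler_pMn2r // dotr_le_eucl.
Qed.

Lemma eucl_triangle w u v : eucl (u - v) <= eucl (u - w) + eucl (w - v).
Proof. by rewrite (le_trans _ (euclD _ _)) // addrA subrK. Qed.

Lemma euclZ (t : R) v : eucl (t *: v) = `|t| * eucl v.
Proof.
rewrite -sqrtr_sqr -sqrtrM ?sqr_ge0 //; congr Num.sqrt.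
by rewrite mulr_sumr; apply: eq_bigr => i _; rewrite mxE exprMn.
Qed.

(** Only positive entries count, because the list of mutual distances used below also contains the
    zero distance of a point to itself. *)
Lemma positive_lower_bound (rs : seq R) :
  exists2 sigma, 0 < sigma & {in rs, forall r, 0 < r -> sigma <= r}.
Proof.
elim: rs => [|r rs [sigma s0 sP]]; first by exists 1.
exists (if 0 < r then Num.min sigma r else sigma).
  by case: ifP => // r0; rewrite lt_min s0 r0.
move=> r'; rewrite inE => /orP[/eqP ->|r'rs] r'0.
  by rewrite r'0 ge_min lexx orbT.
by case: ifP => [r0|_]; rewrite ?ge_min sP.
Qed.

Lemma finite_separation (l : seq 'rV[R]_d) : exists2 sigma, 0 < sigma &
  {in l &, forall y y', y != y' -> sigma <= eucl (y - y')}.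
Proof.
have [sigma s0 sP] := positive_lower_bound
  [seq eucl (y - y') | y <- l, y' <- l].
exists sigma => // y y' yl y'l yy'; apply: sP; first by apply/allpairsP; exists (y, y').
by rewrite lt_def eucl_ge0 eucl_eq0 subr_eq0 yy'.
Qed.

Lemma packing_bound (b e : R) : 0 < e -> exists M : nat,
  forall l : seq 'rV[R]_d, uniq l ->
    {in l &, forall y y', eucl (y - y') <= b} ->
    {in l &, forall y y', y != y' -> e < eucl (y - y')} -> (size l <= M)%N.
Proof.
(* Dividing by [d + 1] avoids a division by zero when [d = 0]. *)
move=> e0; have [c c0 ec] : exists2 c : R, 0 < c & e = d.+1%:R * c.
  by exists (e / d.+1%:R); rewrite ?divr_gt0 // mulrC divfK // pnatr_eq0.
pose N := (Num.truncn ((b + b) / c)).+1.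
exists #|{ffun 'I_d -> 'I_N}| => -[//|y0 l'] ul lb le; set l := y0 :: l' in ul lb le *.
(* [F y] is the cell of [y]; adding [b] makes the coordinates relative to [y0] nonnegative. *)
pose F (y : 'rV[R]_d) : {ffun 'I_d -> 'I_N} :=
  [ffun i => inord (Num.truncn ((y ord0 i - y0 ord0 i + b) / c))].
have bnd y i : y \in l -> 0 <= (y ord0 i - y0 ord0 i + b) / c <= (b + b) / c.
  move=> yl; have := lb _ _ yl (mem_head _ _).
  move=> /(le_trans (eucl_coord_le _ i)); rewrite !mxE ler_norml => /andP[h1 h2].
  rewrite divr_ge0 ?(ltW c0) ?ler_pM2r ?invr_gt0 //; lra.
have Finj : {in l &, injective F}.
  move=> y y' yl y'l FF; apply/eqP/negP => /negP yy'.
  have := le _ _ yl y'l yy'; apply/negP; rewrite -leNgt.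
  apply: le_trans (eucl_le_sum _) _.
  rewrite ec; apply: (@le_trans _ _ (\sum_(i < d) c)).
    apply: ler_sum => i _; rewrite !mxE.
    have /(congr1 val) := congr1 (fun f : {ffun 'I_d -> 'I_N} => f i) FF.
    have /andP[p1 p2] := bnd _ i yl; have /andP[q1 q2] := bnd _ i y'l.
    rewrite !ffunE /= !inordK ?ltnS ?le_truncn // => /(congr1 (fun n : nat => n%:R : R)).
    have /andP[] := truncn_itv p1; have /andP[] := truncn_itv q1.
    set n := (Num.truncn _)%:R; set m := (Num.truncn _)%:R.
    rewrite -!natr1 -/n -/m !ler_pdivlMr // !ltr_pdivrMr // => r1 r2 r3 r4 nm.
    by rewrite ler_norml; apply/andP; split; rewrite nm in r3 r4; nra.
  rewrite sumr_const card_ord -[c *+ d]mulr_natl ler_pM2r // ler_nat //.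
rewrite -(size_map F) cardE uniq_leq_size ?map_inj_in_uniq // => x _.
by rewrite mem_enum.
Qed.

End EuclideanNorm.

(** * Lipschitz branches of a subset of the universal cover *)

Section Branches.
Variables (R : realType) (d : nat).
Implicit Types (f g : R -> 'rV[R]_d) (X : set (R * 'rV[R]_d)) (l : seq 'rV[R]_d).

Definition lipschitz_with (L : R) f :=
  forall u u', eucl (f u - f u') <= L * `|u - u'|.

Definition branching X (delta L : R) := forall s y, X (s, y) ->
  exists f, [/\ lipschitz_with L f, f s = y &
                forall u, `|u - s| <= delta -> X (u, f u)].

Definition in_fibre X (s : R) l := uniq l /\ forall y, y \in l -> X (s, y).

(** Across [a], passing through the common value costs [L * |u - a| + L * |a - u'| = L * |u - u'|],
    so the constant does not grow. *)
Lemma lipschitz_glue L a f g : lipschitz_with L f -> lipschitz_with L g ->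
  f a = g a -> lipschitz_with L (fun u => if u <= a then f u else g u).
Proof.
move=> fL gL fga.
have mix u u' : u <= a -> a < u' -> eucl (f u - g u') <= L * `|u - u'|.
  move=> ua au'; apply: le_trans (eucl_triangle (f a) _ _) _.
  rewrite {2}fga (le_trans (lerD (fL _ _) (gL _ _))) // -mulrDr.
  rewrite !ler0_norm ?subr_le0 ?(ltW au') ?(le_trans ua (ltW au')) //.
  by rewrite (_ : - _ - _ = - (u - u')) //; ring.
move=> u u'; case: (leP u a) => ua; case: (leP u' a) => u'a.
- exact: fL.
- exact: mix.
- by rewrite euclB distrC; exact: mix.
- exact: gL.
Qed.

(** New local branches are started at both end points [s - r] and [s + r] and glued on there. *)
Lemma extend_branch X delta L f s r : branching X delta L -> 0 <= r ->
  lipschitz_with L f -> (forall u, `|u - s| <= r -> X (u, f u)) ->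
  exists g, [/\ lipschitz_with L g, forall u, `|u - s| <= r -> g u = f u &
                forall u, `|u - s| <= r + delta -> X (u, g u)].
Proof.
move=> Xb r0 fL fX.
have [|fl [flL fls flX]] := Xb (s - r) (f (s - r)).
  by apply: fX; rewrite addrAC subrr sub0r normrN ger0_norm.
have [|fr [frL frs frX]] := Xb (s + r) (f (s + r)).
  by apply: fX; rewrite addrAC subrr add0r ger0_norm.
pose m u := if u <= s + r then f u else fr u.
have mE u : u <= s + r -> m u = f u by rewrite /m => ->.
exists (fun u => if u <= s - r then fl u else m u); split.
- apply: lipschitz_glue => //; first by apply: lipschitz_glue.
  by rewrite mE // lerD2l; lra.
- move=> u; rewrite ler_norml => /andP[u1 u2]; rewrite mE; last by lra.
  by case: ifPn => // u3; rewrite (_ : u = s - r) //; lra.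
- move=> u; rewrite ler_norml => /andP[u1 u2].
  case: ifPn => [u3|]; first by apply: flX; rewrite ler_norml; lra.
  rewrite -ltNge => u3; rewrite /m; case: ifPn => [u4|].
    by apply: fX; rewrite ler_norml; lra.
  by rewrite -ltNge => u4; apply: frX; rewrite ler_norml; lra.
Qed.

(** Repeated extension by [delta] on both sides exhausts the line, and each extension keeps the
    values already fixed, so the limit stabilises at every point. *)
Lemma global_branch X delta L s y : 0 < delta -> branching X delta L ->
  X (s, y) -> exists psi, [/\ lipschitz_with L psi, psi s = y &
                              forall u, X (u, psi u)].
Proof.
move=> delta0 Xb Xsy.
pose good n f := lipschitz_with L f /\
  forall u, `|u - s| <= n%:R * delta -> X (u, f u).
(* [choice] wants a value everywhere; a pair that is not [good] keeps its own function as a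
   dummy. *)
have [step stepP] := choice (fun p : nat * (R -> 'rV[R]_d) =>
  ltac:(have [gp|ngp] := pselect (good p.1 p.2);
    [have [g Pg] := extend_branch Xb (mulr_ge0 (ler0n R p.1) (ltW delta0)) gp.1 gp.2;
     by exists g => _; exact: Pg
    |by exists p.2 => gp; case: ngp]) :
  exists g, good p.1 p.2 -> [/\ lipschitz_with L g,
    forall u, `|u - s| <= p.1%:R * delta -> g u = p.2 u &
    forall u, `|u - s| <= p.1%:R * delta + delta -> X (u, g u)]).
have [f0 [f0L f0s f0X]] := Xb _ _ Xsy.
pose F := fix F n := if n is n'.+1 then step (n', F n') else f0.
have Fgood n : good n (F n).
  elim: n => [|n /(stepP (n, F n))[h1 h2 h3]].
    by split=> // u; rewrite mul0r => h; apply: f0X; rewrite (le_trans h) ?ltW.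
  by split=> // u; rewrite -natr1 mulrDl mul1r; exact: h3.
have FE m n u : (m <= n)%N -> `|u - s| <= m%:R * delta -> F n u = F m u.
  move=> /subnKC <-; elim: (n - m)%N => [|k IH] um; first by rewrite addn0.
  rewrite addnS -IH //; have [_ + _] := stepP (m + k, F (m + k))%N (Fgood _).
  by apply; rewrite (le_trans um) // ler_pM2r // ler_nat leq_addr.
(* By stage [idx u] the extensions have reached [u], and later stages do not change the value
   there. *)
pose idx u := (Num.truncn (`|u - s| / delta)).+1.
have idxP u : `|u - s| <= (idx u)%:R * delta.
  rewrite -ler_pdivrMr // ltW //.
  by have /andP[] := truncn_itv (divr_ge0 (normr_ge0 (u - s)) (ltW delta0)).
exists (fun u => F (idx u) u); split.
- move=> u u'; rewrite -(FE _ (maxn (idx u) (idx u'))) ?leq_maxl //.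
  by rewrite -(FE _ (maxn (idx u) (idx u')) u') ?leq_maxr //; exact: (Fgood _).1.
- by rewrite (FE 0) // subrr normr0 mul0r.
- by move=> u; apply: (Fgood _).2.
Qed.

(** Expresses that all fibres have equal cardinality, through finite lists because finiteness of the
    fibres is proved separately. *)
Definition transportable X := forall s u l, in_fibre X s l ->
  exists l', in_fibre X u l' /\ size l' = size l.

(** A longest list over [0] is carried to every fibre and exhausts it: a missing point could be
    adjoined, exceeding the maximum [K]. *)
Lemma constant_fibres X M : transportable X ->
  (forall s l, in_fibre X s l -> (size l <= M)%N) ->
  exists K, forall s, exists l, [/\ in_fibre X s l, size l = K,
    forall y, X (s, y) -> y \in l &
    forall l', in_fibre X s l' -> (size l' <= K)%N].
Proof.
move=> Xt XM.
pose p n := `[< exists l, in_fibre X 0 l /\ size l = n >].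
have p0 : exists n, p n by exists 0%N; apply/asboolP; exists [::].
have pM n : p n -> (n <= M)%N by move=> /asboolP[l [/XM + <-]].
case: (ex_maxnP p0 pM) => K /asboolP[l0 [Xl0 sl0]] Kmax.
have Kle s l : in_fibre X s l -> (size l <= K)%N.
  by move=> /(Xt s 0)[l' [Xl' <-]]; apply: Kmax; apply/asboolP; exists l'.
exists K => s; have [l [[ul Xl] sl]] := Xt 0 s l0 Xl0.
rewrite sl0 in sl.
exists l; split=> // [y Xy|l']; last exact: Kle.
apply/negPn/negP => yl.
suff : (size (y :: l) <= K)%N by rewrite /= sl ltnn.
apply: (Kle s); split=> [|z]; first by rewrite /= yl.
by rewrite inE => /orP[/eqP ->|/Xl].
Qed.

(** The branches through the [K] points over [s] stay distinct nearby, so by counting they fill each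
    nearby fibre. Inside the Lipschitz cone of [y] there is then room for the branch of [y] only. *)
Lemma local_uniqueness X M delta L : 0 < delta -> 0 < L ->
  branching X delta L -> transportable X ->
  (forall s l, in_fibre X s l -> (size l <= M)%N) ->
  forall s, exists2 rho, 0 < rho & forall v p p' y, `|v - s| <= rho ->
    X (s, y) -> X (v, p) -> X (v, p') ->
    eucl (p - y) <= L * `|v - s| -> eucl (p' - y) <= L * `|v - s| -> p = p'.
Proof.
move=> delta0 L0 Xb Xt XM s; have [K KP] := constant_fibres Xt XM.
have [l [[ul Xl] sl lX _]] := KP s.
have [sigma sigma0 sP] := finite_separation l.
have [f fP] := choice (fun y : 'rV[R]_d =>
  ltac:(have [Xy|nXy] := pselect (X (s, y));
    [have [g Pg] := Xb _ _ Xy; by exists g => _; exact: Pg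
    |by exists (fun=> 0) => Xy; case: nXy]) :
  exists g, X (s, y) -> [/\ lipschitz_with L g, g s = y &
                forall u, `|u - s| <= delta -> X (u, g u)]).
have f_near y v : y \in l -> eucl (f y v - y) <= L * `|v - s|.
  by move=> /Xl/fP[+ + _] => /(_ v s) + fs; rewrite fs.
(* With this radius, two points of [l] that are at most [2 * L * |v - s|] apart are within
   [sigma / 2], hence equal. *)
exists (Num.min delta (sigma / (4 * L))).
  by rewrite lt_min delta0 divr_gt0 // mulr_gt0.
move=> v p p' y; rewrite le_min => /andP[vd]; rewrite ler_pdivlMr ?mulr_gt0 // => vs.
move=> /lX yl Xp Xp' py p'y.
have {vs} vs : 4 * (L * `|v - s|) <= sigma by rewrite mulrA mulrC.
have sep y1 y2 : y1 \in l -> y2 \in l ->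
    eucl (y1 - y2) <= 2 * (L * `|v - s|) -> y1 = y2.
  move=> l1 l2 h; apply/eqP/negPn/negP => /(sP _ _ l1 l2); lra.
have lv_uniq : uniq [seq f z v | z <- l].
  rewrite map_inj_in_uniq // => y1 y2 l1 l2 e; apply: sep => //.
  rewrite (le_trans (eucl_triangle (f y1 v) _ _)) // euclB {2}e.
  by have := f_near _ v l1; have := f_near _ v l2; lra.
suff key q : X (v, q) -> eucl (q - y) <= L * `|v - s| -> q = f y v.
  by rewrite (key p) // (key p').
move=> Xq qy; have /mapP[z zl qE] : q \in [seq f z v | z <- l].
  have [lv [_ _ _ /(_ (q :: [seq f z v | z <- l]))]] := KP v.
  apply: contraPT => nq; rewrite /= size_map sl => /(_ _)/negP; rewrite ltnn.
  apply => //; split=> [|y']; first by rewrite /= nq.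
  rewrite inE => /orP[/eqP ->//|/mapP[z zl ->]].
  by have [_ _] := fP _ (Xl _ zl); apply.
rewrite qE; congr (f _ v); apply: sep => //.
rewrite (le_trans (eucl_triangle q _ _)) // {1}qE euclB.
by have := f_near _ v zl; lra.
Qed.

(** The agreement set is open by local uniqueness, closed by continuity and contains [a]; the line
    is connected. *)
Lemma unique_branch X M delta L : 0 < delta -> 0 < L ->
  branching X delta L -> transportable X ->
  (forall s l, in_fibre X s l -> (size l <= M)%N) ->
  forall f g a, lipschitz_with L f -> lipschitz_with L g ->
    (forall u, X (u, f u)) -> (forall u, X (u, g u)) -> f a = g a -> f = g.
Proof.
move=> delta0 L0 Xb Xt XM f g a fL gL fX gX fga.
pose A := [set u | f u = g u].
have Aopen : open A.
  rewrite openE => u; rewrite /A /= => fgu.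
  have [rho rho0 rP] := local_uniqueness delta0 L0 Xb Xt XM u.
  apply/nbhs_ballP; exists rho => //= v; rewrite /ball /= distrC => /ltW vu.
  apply: (rP v _ _ (f u)) => //.
  by rewrite fgu; exact: gL.
have Aclosed : closed A.
  rewrite -(setCK A); apply: open_closedC.
  rewrite openE => u /= /eqP; rewrite -subr_eq0 -eucl_eq0 => ne.
  have e0 : 0 < eucl (f u - g u) by rewrite lt_def ne eucl_ge0.
  (* Within this distance each function moves by less than half the gap at [u]. *)
  apply/nbhs_ballP; exists (eucl (f u - g u) / (2 * L)) => /=.
    by rewrite divr_gt0 // mulr_gt0.
  move=> v; rewrite /ball /= ltr_pdivlMr ?mulr_gt0 // => uv fgv.
  have := eucl_triangle (f v) (f u) (g u); have := fL u v.
  have := gL v u; rewrite fgv (distrC v u) in uv *; lra.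
suff AT : A = setT by apply/funext => u; have : A u by rewrite AT.
have : connected (@setT R) by apply/connected_intervalP => ? ?.
apply; first by exists a.
- by exists A => //; rewrite setTI.
- by exists A => //; rewrite setTI.
Qed.

End Branches.

(** Several points of one fibre may lie on the same closed curve; this selects one point per
    curve. *)
Lemma distinct_representatives (T : eqType) (U : Type) (F : T -> U) (l : seq T) :
  exists l' : seq T, [/\ uniq l', {subset l' <= l}, {in l' &, injective F} &
    forall y, y \in l -> exists2 y', y' \in l' & F y' = F y].
Proof.
elim: l => [|x l [l' [ul' l'l Finj l'F]]]; first by exists [::].
have [[y yl' yx]|nex] := pselect (exists2 y, y \in l' & F y = F x).
  exists l'; split=> // [z /l'l zl|z]; first by rewrite inE zl orbT.
  by rewrite inE => /orP[/eqP ->|/l'F //]; exists y.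
exists (x :: l'); split.
- by rewrite /= ul' andbT; apply/negP => xl'; apply: nex; exists x.
- by move=> z; rewrite !inE => /orP[-> //|/l'l ->]; rewrite orbT.
- move=> y z; rewrite !inE => /orP[/eqP ->|yl'] /orP[/eqP ->|zl'] // yz.
  + by case: nex; exists z.
  + by case: nex; exists y.
  + exact: Finj.
- move=> y; rewrite inE => /orP[/eqP ->|/l'F[y' y'l' <-]].
    by exists x; rewrite ?mem_head.
  by exists y'; rewrite ?inE ?y'l' ?orbT.
Qed.

(** * Decomposition into finitely many periodic curves *)

Section PeriodicCurves.
Variables (R : realType) (d : nat) (X : set (R * 'rV[R]_d)).
Hypothesis Xper : periodic_set X.

Lemma periodic_set_int (k : int) s y : X (s, y) <-> X (s + k%:~R, y).
Proof.
have nat_shift n t : X (t, y) <-> X (t + n%:R, y).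
  elim: n t => [|n IH] t; first by rewrite addr0.
  by rewrite (IH t) Xper -addrA natr1.
case: k => n; first by rewrite -pmulrn; exact: nat_shift.
by rewrite NegzE mulrNz -pmulrn (nat_shift n.+1 (s - n.+1%:R)) subrK.
Qed.

Lemma periodic_int (psi : R -> 'rV[R]_d) (tau : nat) :
  (forall u, psi (u + tau%:R) = psi u) ->
  forall (k : int) u, psi (u + k%:~R * tau%:R) = psi u.
Proof.
move=> per k u; have nat_shift n t : psi (t + n%:R * tau%:R) = psi t.
  elim: n t => [|n IH] t; first by rewrite mul0r addr0.
  by rewrite -natr1 mulrDl mul1r addrA per.
case: k => n; first by rewrite -pmulrn nat_shift.
by rewrite NegzE mulrNz -pmulrn -(nat_shift n.+1) mulNr subrK.
Qed.

Variables (M : nat) (delta L : R).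
Hypotheses (delta0 : 0 < delta) (L0 : 0 < L) (Xb : branching X delta L).
Hypothesis Xt : transportable X.
Hypothesis XM : forall s l, in_fibre X s l -> (size l <= M)%N.

Let unique := unique_branch delta0 L0 Xb Xt XM.

(** The [M + 1] values of [psi] at [0, ..., M] all lie in the fibre over [0], so two coincide;
    uniqueness then identifies the two integer translates of [psi]. *)
Lemma branch_period psi : lipschitz_with L psi -> (forall u, X (u, psi u)) ->
  exists tau : nat, (0 < tau)%N /\ forall u, psi (u + tau%:R) = psi u.
Proof.
move=> psiL psiX; pose l := [seq psi k%:R | k <- iota 0 M.+1].
have shiftL (a : nat) : lipschitz_with L (fun u => psi (u + a%:R)).
  by move=> u u'; rewrite (le_trans (psiL _ _)) // opprD addrACA subrr addr0.
have shiftX (a : nat) u : X (u, psi (u + a%:R)).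
  by apply/(periodic_set_int a); rewrite -pmulrn; exact: psiX.
have /(uniqPn 0)[a [b [ab]]] : ~~ uniq l.
  apply/negP => ul; have : (size l <= M)%N; last by rewrite size_map size_iota ltnn.
  apply: (XM (s := 0)); split=> // y /mapP[k _ ->].
  by have := shiftX k 0; rewrite add0r.
rewrite size_map size_iota => bM.
rewrite !(nth_map 0%N) ?size_iota // ?(ltn_trans ab bM) //.
rewrite !nth_iota // ?(ltn_trans ab bM) // !add0n => psi_ab.
exists (b - a)%N; split=> [|u]; first by rewrite subn_gt0.
have E : (fun u => psi (u + b%:R)) = (fun u => psi (u + a%:R)).
  by apply: (unique (a := 0)) => //; rewrite !add0r.
have := congr1 (fun f : R -> 'rV[R]_d => f (u - a%:R)) E => /=.
by rewrite subrK natrB ?(ltnW ab) // addrA addrAC => ->.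
Qed.

(** Every point lies on a global branch, and this branch is the one chosen through its value at [0];
    the fibre over [0] is finite, so finitely many curves suffice. *)
Lemma union_of_periodic_curves :
  exists (r : nat) (phi : nat -> R -> 'rV[R]_d) (tau : nat -> nat),
     [/\ forall i, (i < r)%N ->
           [/\ (0 < tau i)%N, lipschitz_fun (phi i) &
               forall u, phi i (u + (tau i)%:R) = phi i u],
         X = \bigcup_(i in [set i | (i < r)%N]) curve (phi i) (tau i) &
         forall i j, (i < r)%N -> (j < r)%N -> i <> j ->
           curve (phi i) (tau i) <> curve (phi j) (tau j)].
Proof.
have [K KP] := constant_fibres Xt XM.
have [l [[_ Xl] _ lX _]] := KP 0.
pose good y (p : (R -> 'rV[R]_d) * nat) :=
  [/\ lipschitz_with L p.1, p.1 0 = y, forall u, X (u, p.1 u), (0 < p.2)%N &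
      forall u, p.1 (u + p.2%:R) = p.1 u].
have [p pP] := choice (fun y : 'rV[R]_d =>
  ltac:(have [Xy|nXy] := pselect (X (0, y));
    [have [g [gL g0 gX]] := global_branch delta0 Xb Xy;
     by have [t [t0 tP]] := branch_period gL gX; exists (g, t) => _
    |by exists (fun=> 0, 0%N) => Xy; case: nXy]) :
  exists q, X (0, y) -> good y q).
pose F y := curve (p y).1 (p y).2.
have [l' [ul' l'l Finj l'F]] := distinct_representatives F l.
have nthl i : (i < size l')%N -> nth 0 l' i \in l by move=> ?; apply/l'l/mem_nth.
exists (size l'), (fun i => (p (nth 0 l' i)).1), (fun i => (p (nth 0 l' i)).2).
split=> [i /nthl/Xl/pP[h1 h2 h3 h4 h5]||i j il jl ij].
- by split=> //; exists L.
- apply/seteqP; split=> [[s y] Xsy|[s y] [i /= il [u []]]]; last first.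
    rewrite /= => _ [k ->] ->; rewrite -periodic_set_int.
    by have [_ _ + _ _] := pP _ (Xl _ (nthl i il)).
  have [psi [psiL psis psiX]] := global_branch delta0 Xb Xsy.
  have l0 : psi 0 \in l by exact: lX.
  have [pL p0 pX t0 per] := pP _ (psiX 0).
  have E : psi = (p (psi 0)).1 by exact: (unique (a := 0)).
  have [y' y'l' Fy'] := l'F _ l0.
  exists (index y' l'); first by rewrite /= index_mem.
  rewrite nth_index // -/(F y') Fy' /F.
  set t := (p (psi 0)).2 in t0 per *.
  have t0R : 0 < t%:R :> R by rewrite ltr0n.
  (* Reduces [s] modulo the period [t] to a parameter in [[0, t)]. *)
  pose k := Num.floor (s / t%:R).
  have /andP[k1 k2] := floor_itv (s / t%:R).
  rewrite ler_pdivlMr // -/k in k1; rewrite ltr_pdivrMr // -/k intrD mulrDl mul1r in k2.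
  exists (s - k%:~R * t%:R); split.
  + by rewrite subr_ge0 k1 ltrBlDr addrC.
  + by exists (k * t)%R; rewrite intrM -pmulrn subrK.
  + by rewrite -(periodic_int per k) subrK -E psis.
- move=> /Finj; rewrite !mem_nth // => /(_ isT isT) /eqP.
  by rewrite nth_uniq // => /eqP.
Qed.

End PeriodicCurves.

(** * A mean value inequality for the Euclidean norm *)

Section MeanValue.
Variable R : realType.

Lemma is_derive_line (V W : normedModType R) (f : V -> W) (a v : V) (t : R) :
  derivable f (a + t *: v) v ->
  is_derive t 1 (fun r : R => f (a + r *: v)) ('D_v f (a + t *: v)).
Proof.
move=> fd.
have E : (fun h : R => h^-1 *: (((fun r : R => f (a + r *: v)) \o shift t) (h *: 1)
    - f (a + t *: v))) =
    (fun h : R => h^-1 *: ((f \o shift (a + t *: v)) (h *: v) - f (a + t *: v))).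
  apply/funext => h /=; congr (_ *: (f _ - _)).
  by rewrite [h *: 1]mulr1 scalerDl addrCA.
by apply: DeriveDef; rewrite ?/derivable /derive E.
Qed.

Variables (V : normedModType R) (d : nat).

Lemma differentiable_dotr (e x : 'rV[R]_d) :
  differentiable (fun u : 'rV[R]_d => dotr u e) x.
Proof.
rewrite (_ : (fun u => _) = \sum_(i < d) (fun u : 'rV[R]_d => u ord0 i * e ord0 i)).
  apply: differentiable_sum => i; apply: differentiableM => //.
  exact: differentiable_coord.
by apply/funext => u; rewrite fct_sumE.
Qed.

Lemma diff_dotr (F : V -> 'rV[R]_d) (e : 'rV[R]_d) (x v : V) :
  differentiable F x ->
  differentiable (fun z => dotr (F z) e) x /\
  'd (fun z => dotr (F z) e) x v = dotr ('d F x v) e.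
Proof.
move=> Fd.
have lin : linear (fun u : 'rV[R]_d => dotr u e).
  move=> k u u'; rewrite /dotr scaler_sumr -big_split /=.
  by apply: eq_bigr => i _; rewrite !mxE mulrDl scalerAl.
pose L : {linear 'rV[R]_d -> R} :=
  HB.pack (fun u : 'rV[R]_d => dotr u e) (GRing.isLinear.Build _ _ _ _ _ lin).
have Ld y : differentiable L y by exact: differentiable_dotr.
split; first exact: (@differentiable_comp _ _ _ _ F L).
rewrite (_ : (fun z => _) = L \o F) // diff_comp //.
have -> : ('d L (F x) : 'rV[R]_d -> R) = L; last by [].
by apply: diff_lin => y; apply: differentiable_continuous; exact: Ld.
Qed.

(** The scalar mean value theorem for the inner product of [F] with its own increment [e], followed
    by Cauchy-Schwarz, gives [eucl e ^+ 2 <= K * eucl e]. *)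
Lemma eucl_mean_value (F : V -> 'rV[R]_d) (a v : V) (K : R) :
  (forall t, 0 <= t <= 1 -> differentiable F (a + t *: v)) ->
  (forall t, 0 <= t <= 1 -> eucl ('d F (a + t *: v) v) <= K) ->
  eucl (F (a + v) - F a) <= K.
Proof.
move=> Fd FK; set e := F (a + v) - F a.
pose f z := dotr (F z) e.
have I01 (t : R) : t \in `]0, 1[ -> 0 <= t <= 1.
  by rewrite in_itv /= => /andP[? ?]; rewrite !ltW.
have fd (t : R) : 0 <= t <= 1 ->
      is_derive t 1 (fun r : R => f (a + r *: v)) (dotr ('d F (a + t *: v) v) e).
  move=> t01; have [d1 d2] := diff_dotr e v (Fd _ t01).
  by rewrite -d2 -deriveE //; apply: is_derive_line; exact: diff_derivable.
have [|c c01] := @MVT R (fun r => f (a + r *: v))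
  (fun t => dotr ('d F (a + t *: v) v) e) 0 1 ltr01 (fun t ht => fd t (I01 t ht)).
  apply: derivable_within_continuous => t; rewrite in_itv /= => t01.
  by have [] := fd t t01.
rewrite scale1r scale0r addr0 subr0 mulr1.
have -> : f (a + v) - f a = eucl e ^+ 2.
  by rewrite eucl_sqr /f /dotr -sumrB; apply: eq_bigr => i _; rewrite -mulrBl !mxE.
move=> E; have := dotr_le_eucl ('d F (a + c *: v) v) e.
have {}FK := FK c (I01 _ c01).
rewrite -E expr2; have [->|e0] := eqVneq (eucl e) 0.
  by move=> _; exact: le_trans (eucl_ge0 _) FK.
by rewrite ler_pM2r ?lt_def ?e0 ?eucl_ge0 // => /le_trans; apply.
Qed.

End MeanValue.

(** * Bounded and constant fibre cardinality by pulling back *)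

Section Pullback.
Variables (R : realType) (d : nat) (X : set (R * 'rV[R]_d)).
(** [Z k] models the invariant set [m k] turns of the circle in the past, and [G k] the cocycle map
    bringing it forward to [X]. *)
Variables (Z : nat -> set (R * 'rV[R]_d)) (m : nat -> nat).
Variable G : nat -> R * 'rV[R]_d -> R * 'rV[R]_d.
Variables (lambda eps delta L b : R).
Hypotheses (lambda0 : 0 <= lambda) (lambda1 : lambda < 1) (eps0 : 0 < eps).
Hypotheses (delta0 : 0 < delta) (L0 : 0 < L).
Hypothesis G_onto : forall k s y, X (s, y) ->
  exists2 y', Z k (s - (m k)%:R, y') & G k (s - (m k)%:R, y') = (s, y).
Hypothesis G_into : forall k s y, Z k (s, y) ->
  (G k (s, y)).1 = s + (m k)%:R /\ X (G k (s, y)).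
Hypothesis G_inj : forall k, injective (G k).
Hypothesis G_contract : forall k s y y', Z k (s, y) -> Z k (s, y') ->
  eucl (y - y') <= eps ->
  eucl ((G k (s, y)).2 - (G k (s, y')).2) <= lambda ^+ k * eps.
Hypothesis Z_diameter : forall k s y y', Z k (s, y) -> Z k (s, y') ->
  eucl (y - y') <= b.
Hypothesis Z_branching : forall k, branching (Z k) delta L.

(* Distances at most [eps] shrink forward by [lambda] per step, so finitely
   many distinct points must be more than [eps] apart far enough back. *)
Lemma separated_pullback s l : in_fibre X s l ->
  exists k l', [/\ in_fibre (Z k) (s - (m k)%:R) l', size l' = size l &
    {in l' &, forall y y', y != y' -> eps < eucl (y - y')}].
Proof.
move=> [ul Xl]; have [sigma sigma0 sP] := finite_separation l.
have [k lek] : exists k, lambda ^+ k * eps < sigma.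
  have /cvgrPdist_lt/(_ (sigma / eps) (divr_gt0 sigma0 eps0))[k _ kP] :
    (GRing.exp lambda : R ^nat) x @[x --> \oo] --> 0.
    by apply: cvg_expr; rewrite ger0_norm.
  exists k; rewrite -ltr_pdivlMr //.
  by have := kP k (leqnn k); rewrite /= sub0r normrN ger0_norm ?exprn_ge0.
have [pre preP] := choice (fun y : 'rV[R]_d =>
  ltac:(have [Xy|nXy] := pselect (X (s, y));
    [have [y' Zy' Gy'] := G_onto k Xy; by exists y' => _
    |by exists 0 => Xy; case: nXy]) :
  exists y', X (s, y) ->
    Z k (s - (m k)%:R, y') /\ G k (s - (m k)%:R, y') = (s, y)).
exists k, (map pre l); split; last 2 first.
- by rewrite size_map.
- move=> _ _ /mapP[y yl ->] /mapP[y' y'l ->] ne.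
  rewrite ltNge; apply/negP => near_y.
  have [[Zy Gy] [Zy' Gy']] := (preP _ (Xl _ yl), preP _ (Xl _ y'l)).
  have := G_contract Zy Zy' near_y; rewrite Gy Gy'.
  have yy' : y != y' by apply: contra_neq ne => ->.
  by apply/negP; rewrite -ltNge (lt_le_trans lek) // sP.
split=> [|_ /mapP[y /Xl/preP[? _] ->] //].
rewrite map_inj_in_uniq // => y y' /Xl/preP[_ e] /Xl/preP[_ e'] eq_pre.
by move: e e'; rewrite eq_pre => -> [].
Qed.

(** The packing constant depends on [d], [b] and [eps] but not on the depth [k] of the pull-back. *)
Lemma pullback_size : exists M : nat,
  forall s l, in_fibre X s l -> (size l <= M)%N.
Proof.
have [M MP] := packing_bound d b eps0.
exists M => s l /separated_pullback[k [l' [[ul' Zl'] <- sep]]].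
by apply: MP => // y y' /Zl' Zy /Zl' Zy'; exact: Z_diameter Zy Zy'.
Qed.

(* Once the points are [eps] apart, the [L]-Lipschitz branches through them stay
   disjoint on an interval whose length does not depend on how far one pulled
   back. *)
Lemma local_transport s u l : `|u - s| <= Num.min delta (eps / (4 * L)) ->
  in_fibre X s l -> exists l', in_fibre X u l' /\ size l' = size l.
Proof.
rewrite le_min => /andP[us]; rewrite ler_pdivlMr ?mulr_gt0 // => us_eps.
have {}us_eps : 4 * (L * `|u - s|) <= eps by rewrite mulrA mulrC.
move=> /separated_pullback[k [l' [[ul' Zl'] <- sep]]].
have [f fP] := choice (fun y : 'rV[R]_d =>
  ltac:(have [Zy|nZy] := pselect (Z k (s - (m k)%:R, y));
    [have [g Pg] := Z_branching Zy; by exists g => _; exact: Pg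
    |by exists (fun=> 0) => Zy; case: nZy]) :
  exists g, Z k (s - (m k)%:R, y) -> [/\ lipschitz_with L g,
    g (s - (m k)%:R) = y &
    forall v, `|v - (s - (m k)%:R)| <= delta -> Z k (v, g v)]).
set v := u - (m k)%:R; have vs : v - (s - (m k)%:R) = u - s by rewrite /v; ring.
have Zf y : y \in l' -> Z k (v, f y v).
  by move=> /Zl'/fP[_ _]; apply; rewrite vs.
have f_near y : y \in l' -> eucl (f y v - y) <= L * `|u - s|.
  by rewrite -vs => /Zl'/fP[/(_ v (s - (m k)%:R)) + fs _]; rewrite fs.
exists [seq (G k (v, f y v)).2 | y <- l']; rewrite size_map; split=> //; split.
  rewrite map_inj_in_uniq // => y y' yl y'l e2.
  (* Equal images make the two branches meet over [v]; then [y] and [y'] are within [eps / 2],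
     against their separation. *)
  have : G k (v, f y v) = G k (v, f y' v).
    rewrite [LHS]surjective_pairing [RHS]surjective_pairing e2.
    by rewrite (G_into (Zf _ yl)).1 (G_into (Zf _ y'l)).1.
  move=> /G_inj[e]; apply/eqP/negPn/negP => /(sep _ _ yl y'l).
  have := eucl_triangle (f y v) y y'; rewrite (euclB y (f y v)) {2}e.
  by have := f_near _ yl; have := f_near _ y'l; have := eps0; lra.
move=> _ /mapP[y yl ->]; have [G1 +] := G_into (Zf _ yl).
by rewrite [G _ _]surjective_pairing G1 /v subrK.
Qed.

(** The admissible step [eta] is the same at every base point, so finitely many equal steps lead
    from [s] to [u]. *)
Lemma pullback_transportable : transportable X.
Proof.
set eta := Num.min delta (eps / (4 * L)).
have eta0 : 0 < eta by rewrite lt_min delta0 divr_gt0 // mulr_gt0.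
suff steps n s u l : `|u - s| <= n%:R * eta -> in_fibre X s l ->
    exists l', in_fibre X u l' /\ size l' = size l.
  move=> s u l; apply: (steps (Num.truncn (`|u - s| / eta)).+1).
  rewrite -ler_pdivrMr // ltW //.
  by have /andP[] := truncn_itv (divr_ge0 (normr_ge0 (u - s)) (ltW eta0)).
elim: n s l => [|n IH] s l.
  rewrite mul0r normr_le0 subr_eq0 => /eqP -> Xl.
  by exists l.
move=> us Xl; have n0 : 0 < n.+1%:R :> R by rewrite ltr0n.
pose s' := s + (u - s) / n.+1%:R.
have [|l1 [Xl1 <-]] := @local_transport s s' l _ Xl.
  rewrite /s' addrAC subrr add0r normrM normfV (ger0_norm (ltW n0)).
  by rewrite ler_pdivrMr // mulrC.
apply: (IH s') => //.
have -> : u - s' = (u - s) * (n%:R / n.+1%:R).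
  have -> : n%:R = n.+1%:R - 1 :> R by rewrite -natr1 addrK.
  by rewrite /s'; rewrite [(n.+1%:R - 1) / _]mulrBl divff ?gt_eqF // mul1r; ring.
rewrite normrM (ger0_norm (divr_ge0 _ _)) ?ler0n // mulrA ler_pdivrMr //.
by rewrite -[leRHS]mulrA [leLHS]mulrC [eta * _]mulrC ler_wpM2l.
Qed.

End Pullback.

(** * The cocycle on the invariant set and its contraction *)

Section Dynamics.
Variables (R : realType) (d : nat) (dO : measure_display).
Variables (Omega : measurableType dO) (P : probability Omega R).
Variable theta : R -> Omega -> Omega.
Hypothesis theta_mds : metric_dynamical_system P theta.

Lemma ae_preserved (Q : Omega -> Prop) t :
  {ae P, forall w, Q w} -> {ae P, forall w, Q (theta t w)}.
Proof.
case: theta_mds => mtheta Ptheta _ _ [A [mA PA0 QA]].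
exists (theta t @^-1` A); split; first 2 last.
- by move=> w /QA.
- by rewrite -[_ @^-1` _]setTI; exact: mtheta.
- by rewrite Ptheta.
Qed.

Lemma theta_flow t u w : theta t (theta u w) = theta (t + u) w.
Proof. by case: theta_mds => _ _ _ ->. Qed.

Lemma theta_id w : theta 0 w = w.
Proof. by case: theta_mds => _ _ ->. Qed.

Variable gamma : R -> Omega -> R * 'rV[R]_d -> R * 'rV[R]_d.
Hypothesis gamma_cocycle : C1_perfect_cocycle theta gamma.

Lemma cocycleD t u w z : gamma (t + u) w z = gamma u (theta t w) (gamma t w z).
Proof. by have [_ -> _ _ _] := gamma_cocycle.2 w. Qed.

Lemma cocycle0 w z : gamma 0 w z = z.
Proof. by have [-> _ _ _ _] := gamma_cocycle.2 w. Qed.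

Lemma cocycle_inj t w : injective (gamma t w).
Proof.
have [_ _ _ _ /(_ t)[g [gK _ _ _]]] := gamma_cocycle.2 w; exact: can_inj gK.
Qed.

Lemma cocycle_differentiable t w z : differentiable (gamma t w) z.
Proof. by have [_ _ _ _ /(_ t)[g [_ _ [] ]]] := gamma_cocycle.2 w. Qed.

Lemma Hn_cocycle t1 n w : Hn theta gamma t1 n w = gamma (n%:R * t1) w.
Proof.
have iter_theta k : iter k (theta t1) w = theta (k%:R * t1) w.
  elim: k => [|k IH] /=; first by rewrite mul0r theta_id.
  by rewrite IH theta_flow -natr1 mulrDl mul1r addrC.
elim: n => [|n IH]; apply/funext => z /=; first by rewrite mul0r cocycle0.
by rewrite IH iter_theta -cocycleD -natr1 mulrDl mul1r.
Qed.

Variables (Y : Omega -> set 'rV[R]_d) (X : Omega -> set (R * 'rV[R]_d)) (t1 : R).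
Hypothesis XY : condition_i theta gamma Y X t1.

Lemma X_invariant t w z : X w z -> X (theta t w) (gamma t w z).
Proof. by move=> Xz; have [_ _ _ _ [<- _ _ _]] := XY; exists z. Qed.

(** The orbit stays in the invariant set, whose fibres lie in [Y], so each time [t1] adds exactly
    one turn. *)
Lemma X_shift n w z : X w z -> (gamma (n%:R * t1) w z).1 = z.1 + n%:R.
Proof.
move=> Xz; elim: n => [|n IH]; first by rewrite mul0r cocycle0 addr0.
rewrite -natr1 mulrDl mul1r cocycleD addrA -IH.
have := X_invariant (n%:R * t1) Xz.
have [_ _ turn _ [_ XinY _ _]] := XY.
by case: (gamma _ w z) => s y /XinY/(turn _ s)[-> _].
Qed.

Variables (lambda eps : R) (n0 : nat).
Hypotheses (lambda0 : 0 <= lambda) (lambda1 : lambda < 1) (eps0 : 0 < eps).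

Definition contracting w := forall z, Bnbhd (X w) eps z -> forall v : 'rV[R]_d,
  eucl ('d (fun x => (Hn theta gamma t1 n0 w x).2) z (0, v)) <= lambda * eucl v.

(** The vertical segment from [y] to [y'] stays in the [eps]-neighbourhood, where the derivative
    bound feeds the mean value inequality. *)
Lemma contraction_step w s y y' : contracting w -> X w (s, y) ->
  eucl (y' - y) <= eps ->
  eucl ((gamma (n0%:R * t1) w (s, y')).2 - (gamma (n0%:R * t1) w (s, y)).2)
    <= lambda * eucl (y' - y).
Proof.
move=> wc Xy yy'; set F := fun z => (gamma (n0%:R * t1) w z).2.
have E (t : R) : (s, y) + t *: (0, y' - y) = (s, y + t *: (y' - y)) :> R * 'rV[R]_d.
  by transitivity (s + t * 0, y + t *: (y' - y)); rewrite // mulr0 addr0.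
have -> : gamma (n0%:R * t1) w (s, y') = gamma (n0%:R * t1) w ((s, y) + (0, y' - y)).
  by rewrite -[X in _ + X]scale1r E scale1r addrC subrK.
apply: (eucl_mean_value (F := F) (a := (s, y)) (v := (0, y' - y))) => t t01.
  apply: (@differentiable_comp _ _ _ _ (gamma (n0%:R * t1) w) snd).
    exact: cocycle_differentiable.
  apply: linear_differentiable => z; exact: cvg_snd.
rewrite E; have := wc (s, y + t *: (y' - y)); rewrite Hn_cocycle; apply.
exists y; split=> //=; rewrite addrC addKr euclZ.
by case/andP: t01 => t0 t1'; rewrite ger0_norm // (le_trans _ yy') // ler_piMl ?eucl_ge0.
Qed.

(** After each block both images lie over the same circle coordinate and are still within [eps], so
    the one-step estimate applies again. *)
Lemma contraction_iter k w s y y' :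
  (forall j, (j < k)%N -> contracting (theta ((n0 * j)%N%:R * t1) w)) ->
  X w (s, y) -> X w (s, y') -> eucl (y - y') <= eps ->
  eucl ((gamma ((n0 * k)%N%:R * t1) w (s, y)).2 -
        (gamma ((n0 * k)%N%:R * t1) w (s, y')).2) <= lambda ^+ k * eps.
Proof.
move=> wc Xy Xy' yy'; elim: k wc => [|k IH] wc.
  by rewrite muln0 mul0r !cocycle0 mul1r.
have {}IH := IH (fun j jk => wc j (ltnW jk)).
rewrite mulnSr natrD mulrDl !cocycleD.
set t := (n0 * k)%N%:R * t1.
have := X_shift (n0 * k) Xy; have := X_shift (n0 * k) Xy'.
have := X_invariant t Xy'; have := X_invariant t Xy; rewrite -/t in IH *.
case: (gamma t w (s, y)) IH => r x; case: (gamma t w (s, y')) => r' x' /= IH.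
move=> Xx Xx' rs' rs; rewrite rs' -rs in Xx' *.
apply: le_trans (contraction_step (wc k (ltnSn k)) Xx' _) _.
  by rewrite (le_trans IH) // ler_piMl ?(ltW eps0) // exprn_ile1 // ltW.
by rewrite exprS -mulrA ler_wpM2l.
Qed.

(** Instantiates the pull-back with [Z k] at time [-(n0 * k) * t1]; invariance in both time
    directions makes [G k] carry [Z k] onto [X w]. *)
Lemma pullback_curves w : condition_ii X ->
  (forall k, contracting (theta (- ((n0 * k)%N%:R * t1)) w)) ->
  exists (r : nat) (phi : nat -> R -> 'rV[R]_d) (tau : nat -> nat),
     [/\ forall i, (i < r)%N ->
           [/\ (0 < tau i)%N, lipschitz_fun (phi i) &
               forall u, phi i (u + (tau i)%:R) = phi i u],
         X w = \bigcup_(i in [set i | (i < r)%N]) curve (phi i) (tau i) &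
         forall i j, (i < r)%N -> (j < r)%N -> i <> j ->
           curve (phi i) (tau i) <> curve (phi j) (tau j)].
Proof.
move=> [delta [L [delta0 L0 Xb]]] wc.
have {}Xb w' : branching (X w') delta L.
  move=> s y /Xb[f [_ fL fs fX]]; exists f; split=> // u.
  by rewrite ler_norml => /andP[u1 u2]; apply: fX; lra.
have [_ _ _ [Xcirc _] [Xinv _ _ [b [b0 Xdiam]]]] := XY.
pose t k := (n0 * k)%N%:R * t1.
pose Z k := X (theta (- t k) w).
pose m k := (n0 * k)%N.
pose G k := gamma (t k) (theta (- t k) w).
have back k : theta (t k) (theta (- t k) w) = w.
  by rewrite theta_flow subrr theta_id.
have G_onto k s y : X w (s, y) ->
  exists2 y', Z k (s - (m k)%:R, y') & G k (s - (m k)%:R, y') = (s, y).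
  rewrite -{1}(back k) -Xinv => -[[s' y'] Zz Gz]; exists y'.
    by have := X_shift (m k) Zz; rewrite -/(t k) Gz /= => ->; rewrite addrK.
  rewrite -Gz; congr (G k (_, _)); apply/eqP; rewrite subr_eq.
  by have := X_shift (m k) Zz; rewrite -/(t k) Gz /= => ->.
have G_into k s y : Z k (s, y) ->
  (G k (s, y)).1 = s + (m k)%:R /\ X w (G k (s, y)).
  move=> Zz; split; first exact: X_shift.
  by rewrite -{1}(back k); exact: X_invariant.
have G_inj k : injective (G k) by exact: cocycle_inj.
have G_contract k s y y' : Z k (s, y) -> Z k (s, y') -> eucl (y - y') <= eps ->
  eucl ((G k (s, y)).2 - (G k (s, y')).2) <= lambda ^+ k * eps.
  apply: contraction_iter => j jk; rewrite theta_flow.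
  (* Moving [j] blocks forward from the [k]-th past point gives the [(k - j)]-th one, where
     contraction is assumed. *)
  rewrite (_ : _ + _ = - t (k - j)%N); first exact: wc.
  by rewrite /t mulnBr natrB ?leq_mul2l ?(ltnW jk) ?orbT //; ring.
have Z_diameter k s y y' : Z k (s, y) -> Z k (s, y') -> eucl (y - y') <= b.
  by move=> Zy Zy'; exact/ltW/(Xdiam _ _ _ _ Zy Zy').
have Z_branching k : branching (Z k) delta L by exact: Xb.
have [M XM] := pullback_size lambda0 lambda1 eps0 G_onto G_contract Z_diameter.
have Xt := pullback_transportable lambda0 lambda1 eps0 delta0 L0
  G_onto G_into G_inj G_contract Z_branching.
exact: (union_of_periodic_curves (Xcirc w).1 delta0 L0 (Xb w) Xt XM).
Qed.

End Dynamics.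

(** * Almost every backward orbit is contracting *)

Unset Implicit Arguments.
Set Strict Implicit.

Theorem theorem3p8 (R : realType) (d : nat) (dO : measure_display)
  (Omega : measurableType dO) (P : probability Omega R)
  (theta : R -> Omega -> Omega)
  (gamma : R -> Omega -> R * 'rV[R]_d -> R * 'rV[R]_d)
  (Y : Omega -> set 'rV[R]_d) (X : Omega -> set (R * 'rV[R]_d)) (t1 : R) :
  metric_dynamical_system P theta ->
  C1_perfect_cocycle theta gamma ->
  condition_i theta gamma Y X t1 ->
  condition_ii X ->
  condition_iii P theta gamma X t1 ->
  {ae P, forall w, exists (r : nat) (phi : nat -> R -> 'rV[R]_d) (tau : nat -> nat),
     [/\ forall i, (i < r)%N ->
           [/\ (0 < tau i)%N, lipschitz_fun (phi i) &
               forall u, phi i (u + (tau i)%:R) = phi i u],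
         X w = \bigcup_(i in [set i | (i < r)%N]) curve (phi i) (tau i) &
         forall i j, (i < r)%N -> (j < r)%N -> i <> j ->
           curve (phi i) (tau i) <> curve (phi j) (tau j)]}.
Proof.
move=> mds coc ci cii [lambda [eps [n0 [lambda1 eps0 contr _]]]].
(* [lambda] may be negative; its maximum with [0] is still below [1] and has nonnegative powers. *)
have contr' : {ae P, forall w,
    contracting theta gamma X t1 (Num.max lambda 0) eps n0 w}.
  apply: filterS contr => w wc z Bz v; apply: le_trans (wc z Bz v) _.
  by rewrite ler_wpM2r ?eucl_ge0 // le_max lexx.
(* Each past time costs one null set by invariance of [P], and there are only countably many. *)
have all_contr : {ae P, forall w, forall k : nat,
    contracting theta gamma X t1 (Num.max lambda 0) eps n0
      (theta (- ((n0 * k)%N%:R * t1)) w)}.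
  by apply: ae_foralln => k; exact: (ae_preserved mds _ contr').
apply: filterS all_contr => w wc.
apply: (pullback_curves mds coc ci _ _ eps0 cii wc).
  by rewrite le_max lexx orbT.
by rewrite gt_max lambda1 ltr01.
Qed.
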